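(* Let $X$ be a Banach space and let $\{x_\alpha\}_{\alpha<\kappa}\subset X$ be a normalized sequence (i.e. $\|x_\alpha\|=1$ for all $\alpha<\kappa$), where $\kappa$ is an uncountable regular cardinal. (1) If $\{x_\alpha\}_{\alpha<\kappa}$ is weakly null, then there is a subsequence $\{x_{\alpha_\sigma}\}_{\sigma<\kappa}$ which forms a monotone basic sequence. (2) If $X$ has Corson's property $(C)$ and $\{x_\alpha\}_{\alpha<\kappa}$ is dispersed (resp. strongly dispersed), then there is a subsequence $\{x_{\alpha_\sigma}\}_{\sigma<\kappa}$ which forms a bounded biorthogonal sequence (resp. a monotone basic sequence). Moreover, each nonseparable Plichko space contains an uncountable monotone basic sequence.
   Context: Banach spaces are real and infinite-dimensional. $[A]$ denotes the closed linear span of $A$. A subsequence of a sequence indexed by $\kappa$ is given by a strictly increasing map $\sigma\mapsto\alpha_\sigma$ into $\kappa$. A sequence $\{x_\alpha\}_{\alpha<\kappa}$ is weakly null if for each $f\in X^*$, $f(x_\alpha)\to 0$ as $\alpha\to\kappa$. For a limit ordinal $\theta$, $\{x_\alpha\}_{\alpha<\theta}\subset X\setminus\{0\}$ is a (transfinite) basic sequence if there is $1\le C<\infty$ such that $\|y\|\le C\|y+z\|$ for all $\lambda<\theta$, $y\in[x_\alpha:\alpha<\lambda]$ and $z\in[x_\alpha:\lambda\le\alpha<\theta]$; it is monotone if one can take $C=1$. For a limit ordinal $\lambda$, a sequence $\{x_\alpha\}_{\alpha<\lambda}$ is dispersed if $\bigcap_{\gamma<\lambda}[x_\alpha:\gamma<\alpha<\lambda]\subsetneq[x_\alpha:\beta<\alpha<\lambda]$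 for all $\beta<\lambda$; it is strongly dispersed if it is dispersed and $\bigcap_{\beta<\lambda}[x_\alpha:\beta<\alpha<\lambda]=\{0\}$. A sequence $\{x_\alpha\}_\alpha\subset X$ is a biorthogonal sequence if there are $x^*_\alpha\in X^*$ with $x^*_\alpha(x_\beta)=\delta_{\alpha,\beta}$; it is bounded if the functionals can be chosen with $\sup_\alpha\|x_\alpha\|\,\|x^*_\alpha\|<\infty$. $X$ has property $(C)$ if each family of closed convex subsets of $X$ with empty intersection has a countable subfamily with empty intersection. An M-basis of $X$ is a biorthogonal system $\{(x_\gamma,x_\gamma^* )\}_{\gamma\in\Gamma}$ with $[x_\gamma:\gamma\in\Gamma]=X$ and $[x^*_\gamma:\gamma\in\Gamma]$ weak-star dense in $X^*$. A subspace $Y\subset X^*$ is $1$-norming if $\|x\|=\sup\{f(x):f\in Y,\|f\|=1\}$ for all $x\in X$. $X$ is Plichko if it admits a countably $1$-norming M-basis, that is, an M-basis $\{x_\gamma\}_{\gamma\in\Gamma}$ such that $\{f\in X^*:|\{\gamma:f(x_\gamma)\ne0\}|\le\aleph_0\}$ is a $1$-norming subspace of $X^*$. *)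

(* Defs.v *)
From HB Require Import structures.
From mathcomp Require Import all_boot all_order all_algebra.
From mathcomp Require Import all_classical all_reals all_analysis.

Set Implicit Arguments.
Unset Strict Implicit.
Unset Printing Implicit Defensive.

Import Order.TTheory GRing.Theory Num.Theory.
Import numFieldNormedType.Exports.

Local Open Scope classical_set_scope.
Local Open Scope card_scope.
Local Open Scope ring_scope.

(* An ordinal is represented by a well-ordered type T whose elements stand for
   the ordinals below it; a sequence of that length is a map out of T. *)

Definition limit_ordinal d (T : orderType d) : Prop :=
  [/\ wochoice.well_order (<=%O : rel T), [set: T] !=set0 &
      forall a : T, exists b, (a < b)%O].

(* The first two conditions say that the order type of K is an initial ordinal,
   i.e. a cardinal; the last one, that each unbounded subset of K has as many
   elements as K, i.e. cf K = K. *)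
Definition uncountable_regular_cardinal d (K : orderType d) : Prop :=
  [/\ wochoice.well_order (<=%O : rel K),
      forall a : K, ~ ([set: K] #<= [set b | (b < a)%O]),
      ~ countable [set: K] &
      forall A : set K, (forall a, exists2 b, A b & (a <= b)%O) ->
        [set: K] #<= A].

Definition linear_span (R : realType) (V : lmodType R) (A : set V) : set V :=
  [set y | exists n (c : 'I_n -> R) (v : 'I_n -> V),
     (forall i, A (v i)) /\ y = \sum_(i < n) c i *: v i].

Definition infinite_dimensional (R : realType) (V : lmodType R) : Prop :=
  ~ exists2 A : set V, finite_set A & linear_span A = setT.

Definition separable (T : topologicalType) : Prop :=
  exists2 A : set T, countable A & dense A.

Section BanachSpace.
Variables (R : realType) (X : completeNormedModType R).

Definition closed_span (A : set X) : set X := closure (linear_span A).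

Definition dual : set (X -> R^o) := [set f | linear f /\ continuous f].

(* Junk value 0 if f is unbounded on the unit ball, which does not occur for f
   in dual. *)
Definition dual_norm (f : X -> R^o) : R :=
  sup [set `|f x| | x in [set x | `|x| <= 1]].

(* [A] computed in X^* with its norm topology. *)
Definition dual_closed_span (A : set (X -> R^o)) : set (X -> R^o) :=
  [set f | dual f /\ forall e : R, 0 < e ->
     exists2 g, linear_span A g & dual_norm (f - g) < e].

(* The weak-star topology of X^* is the one induced by the pointwise topology
   of the space of all functions on X. *)
Definition weak_star_dense (D : set (X -> R^o)) : Prop :=
  dual `<=` closure (D : set {ptws X -> R^o}).

Definition property_C : Prop :=
  forall F : set (set X),
    (forall A, F A -> closed A /\ convex_set (A : set (convex_lmodType X))) ->
    \bigcap_(A in F) A = set0 ->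
    exists G : set (set X),
      [/\ G `<=` F, countable G & \bigcap_(A in G) A = set0].

Section Sequences.
Variables (d : Order.disp_t) (T : orderType d).
Implicit Type x : T -> X.

Definition tails : set_system T :=
  filter_from setT (fun b => [set a | (b <= a)%O]).

Definition weakly_null x : Prop :=
  forall f, dual f -> f (x a) @[a --> tails] --> (0 : R^o).

Definition basic_sequence_with (C : R) x : Prop :=
  (forall a, x a != 0) /\
  forall (l : T) (y z : X),
    closed_span (x @` [set a | (a < l)%O]) y ->
    closed_span (x @` [set a | (l <= a)%O]) z ->
    `|y| <= C * `|y + z|.

Definition monotone_basic_sequence x : Prop := basic_sequence_with 1 x.

Definition tail_span x (b : T) : set X :=
  closed_span (x @` [set a | (b < a)%O]).

Definition dispersed x : Prop :=
  forall b, \bigcap_(g in [set: T]) tail_span x g `<` tail_span x b.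

Definition strongly_dispersed x : Prop :=
  dispersed x /\ \bigcap_(b in [set: T]) tail_span x b = [set 0].

Definition has_subsequence (P : (T -> X) -> Prop) x : Prop :=
  exists s : T -> T, {homo s : a b / (a < b)%O} /\ P (x \o s).

End Sequences.

Definition biorthogonal (I : eqType) (x : I -> X) (xs : I -> X -> R^o) : Prop :=
  (forall a, dual (xs a)) /\ forall a b, xs a (x b) = (a == b)%:R.

Definition bounded_biorthogonal_sequence (I : eqType) (x : I -> X) : Prop :=
  exists2 xs, biorthogonal x xs &
    exists M : R, forall a, `|x a| * dual_norm (xs a) <= M.

Definition M_basis (I : eqType) (x : I -> X) (xs : I -> X -> R^o) : Prop :=
  [/\ biorthogonal x xs, closed_span (range x) = setT &
      weak_star_dense (dual_closed_span (range xs))].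

Definition one_norming (Y : set (X -> R^o)) : Prop :=
  forall x : X, (`|x|)%:E =
    ereal_sup [set (f x)%:E | f in [set f | Y f /\ dual_norm f = 1]].

Definition plichko : Prop :=
  exists (I : eqType) (x : I -> X) (xs : I -> X -> R^o),
    M_basis x xs /\
    one_norming [set f | dual f /\ countable [set i | f (x i) != 0]].

End BanachSpace.

(* Main.v *)
(* Call a family in K small if every map from it into K is bounded; by regularity, proper
   initial segments, countable sets, and finite rational combinations over a small set are small.
   In each part, every vector y admits an index b past which all z in the tail span satisfy
   q y <= |y + z|, where q is the norm (or, for dispersed sequences, the distance to the
   intersection of the tail spans).  For weakly null sequences, and for Plichko spaces, this holds
   because functionals almost norming y vanish eventually along the sequence; under property (C),
   because the sets of z in the tails violating it by 1/n are closed, convex, and have empty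
   intersection.  Transfinite recursion then places each new index past the b of all rational
   combinations of the previous terms.  For dispersed sequences the resulting inequalities bound
   from below the distance of each term to the span of the others, and Hahn-Banach gives the
   biorthogonal functionals.  For Plichko spaces one runs this over an initial segment of order
   type omega_1 of a well-ordering of the (uncountable) M-basis. *)
Require Import Defs.
From HB Require Import structures.
From mathcomp Require Import all_boot all_order all_algebra.
From mathcomp Require Import all_classical all_reals all_analysis.
Import numFieldNormedType.Exports.
Local Open Scope classical_set_scope.
Local Open Scope ring_scope.
Import Order.TTheory GRing.Theory Num.Theory.
Set Implicit Arguments.
Unset Strict Implicit.
Unset Printing Implicit Defensive.

(** * Small sets in regular well-orders *)

Definition small d (K : orderType d) U (A : set U) : Prop :=
  forall g : U -> K, exists b, forall u, A u -> (g u < b)%O.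

(** Abstracts what the selection argument uses of an uncountable regular cardinal, so that it
    applies equally to an order of type omega_1. *)
Definition regular_order d (K : orderType d) : Prop :=
  [/\ wochoice.well_order (<=%O : rel K),
      forall U (A : set U), countable A -> small K A &
      forall a : K, small K [set b | (b < a)%O]].

Section RegularOrder.
Context {d : Order.disp_t} {K : orderType d}.

(** An unbounded map on [A] has cofinal image; by regularity this image has as many elements as [K],
    and an image of [A] is no larger than [A]. *)
Lemma not_small_card_le U (A : set U) :
  (forall B : set K, (forall a, exists2 b, B b & (a <= b)%O) ->
     ([set: K] #<= B)%card) ->
  ~ small K A -> ([set: K] #<= A)%card.
Proof.
move=> reg /existsNP[g /forallNP gub].
apply: card_le_trans (card_image_le g A); apply: reg => a.
have /existsNP[u /not_implyP[Au /negP]] := gub a.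
by rewrite -leNgt => agu; exists (g u) => //; exists u.
Qed.

Lemma uncountable_regular_order :
  uncountable_regular_cardinal K -> regular_order K.
Proof.
move=> [wo ini unc reg]; split=> // [U A cA|a]; apply: contrapT;
  move=> /(not_small_card_le reg) KA.
- by apply: unc; apply: sub_countable KA cA.
- exact: ini KA.
Qed.

Lemma well_order_min (P : set K) : wochoice.well_order (<=%O : rel K) ->
  P !=set0 -> exists2 m, P m & forall b, P b -> (m <= b)%O.
Proof.
move=> wo [p Pp]; have [|m [[Pm mP] _]] := wo (fun b => `[< P b >]).
  by exists p; apply/asboolP.
exists m; first exact/asboolP.
by move=> b Pb; apply: mP; apply/asboolP.
Qed.

Lemma well_order_wf : wochoice.well_order (<=%O : rel K) ->
  well_founded (fun a b : K => (a < b)%O).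
Proof.
move=> wo a; apply: contrapT => na.
have [|m nm mP] := @well_order_min [set b | ~ Acc (fun a b : K => (a < b)%O) b] wo.
  by exists a.
apply: nm; constructor=> b bm; apply: contrapT => /mP.
by rewrite leNgt bm.
Qed.

(** Transfinite recursion with a relational step: the second hypothesis says that [P l f v] reads
    [f] only below [l], so the values built so far may stand in for the whole function. *)
Lemma well_order_choice (P : K -> (K -> K) -> K -> Prop) :
  wochoice.well_order (<=%O : rel K) ->
  (forall l f, exists v, P l f v) ->
  (forall l f g v, (forall a, (a < l)%O -> f a = g a) -> P l f v -> P l g v) ->
  exists s : K -> K, forall l, P l s (s l).
Proof.
move=> wo exP Ploc; have [F FP] := choice (fun lf => exP lf.1 lf.2).
(* The value [l] off the segment is a filler; locality of [P] makes it harmless. *)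
pose step l (rec : forall a, (a < l)%O -> K) : K :=
  F (l, fun a => if pselect (a < l)%O is left al then rec a al else l).
pose s := Fix (well_order_wf wo) (fun=> K) step.
exists s => l.
have -> : s l = step l (fun a _ => s a).
  rewrite /s Fix_eq// => k f g fg; rewrite /step; congr (F (_, _)); apply/funext => a.
  by case: pselect.
pose r a := if pselect (a < l)%O is left _ then s a else l.
apply: (Ploc l r s _ _ (FP (l, r))) => a al; rewrite /r.
by case: pselect.
Qed.

(** For a fixed length, induct on it: bound over the tail, then over the countably many rational
    coefficients, then over [A]. Finally bound over the countably many lengths. *)
Lemma small_lists (U : eqType) (A : pred U) : regular_order K ->
  small K [set u | A u] ->
  small K [set L : seq (rat * U) | all (A \o snd) L].
Proof.
move=> [_ small_countable _] smallA.
have small_rat : small K [set: rat] by exact: small_countable.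
have small_nat : small K [set: nat] by exact: small_countable.
have small_size n (g : seq (rat * U) -> K) :
    exists b, forall L, size L = n -> all (A \o snd) L -> (g L < b)%O.
  elim: n g => [|n IHn] g.
    have [b gb] := small_rat (fun=> g [::]).
    by exists b => L /size0nil-> _; apply: (gb 0).
  have [h hP] := choice (fun p => IHn (fun L => g (p :: L))).
  have [k kP] := choice (fun u => small_rat (fun r => h (r, u))).
  have [b bP] := smallA k.
  exists b => -[|[r u] L]//= [sL] /andP[Au AL].
  exact/(lt_trans (hP (r, u) _ sL AL))/(lt_trans (kP u r I))/bP.
move=> g; have [h hP] := choice (fun n => small_size n g).
have [b bP] := small_nat h.
by exists b => L /= AL; apply: lt_trans (hP _ _ erefl AL) (bP _ I).
Qed.

End RegularOrder.

(** * Closed spans and their countable dense parts *)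

Definition linear_subset (R : realType) (V : lmodType R) (S : set V) : Prop :=
  S 0 /\ forall c u v, S u -> S v -> S (c *: u + v).

Section LinearSpan.
Context {R : realType} {V : lmodType R}.
Implicit Types A S : set V.

Lemma linear_subsetD S u v : linear_subset S -> S u -> S v -> S (u + v).
Proof. by move=> [_ SD] Su Sv; rewrite -[u]scale1r; exact: SD. Qed.

Lemma linear_subsetZ S c u : linear_subset S -> S u -> S (c *: u).
Proof. by move=> [S0 SD] Su; rewrite -[_ *: _]addr0; exact: SD. Qed.

Lemma linear_subsetN S u : linear_subset S -> S u -> S (- u).
Proof. by rewrite -scaleN1r; exact: linear_subsetZ. Qed.

Lemma linear_span_sub A S : linear_subset S -> A `<=` S -> linear_span A `<=` S.
Proof.
move=> [S0 SD] AS _ [n [c [v [Av ->]]]].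
by apply: (big_rec S) => // i y _; apply: SD; apply: AS.
Qed.

Lemma sub_linear_span A : A `<=` linear_span A.
Proof.
move=> v Av; exists 1, (fun=> 1), (fun=> v); split=> //.
by rewrite big_ord1 scale1r.
Qed.

Lemma linear_span_linear A : linear_subset (linear_span A).
Proof.
split; first by exists 0, (fun=> 0), (fun=> 0); split=> [[]//|]; rewrite big_ord0.
move=> a _ _ [m [c [v [Av ->]]]] [n [e [w [Aw ->]]]].
exists (m + n)%N, (fun i => match fintype.split i with inl j => a * c j | inr j => e j end),
  (fun i => match fintype.split i with inl j => v j | inr j => w j end).
split=> [i|]; first by case: fintype.split.
rewrite big_split_ord/= scaler_sumr; congr (_ + _); apply: eq_bigr => i _.
  by rewrite (unsplitK (inl i)) scalerA.
by rewrite (unsplitK (inr i)).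
Qed.

Lemma linear_span_subset A A' : A `<=` A' -> linear_span A `<=` linear_span A'.
Proof.
move=> AA'; apply: linear_span_sub (linear_span_linear _) _.
exact: subset_trans AA' (@sub_linear_span _).
Qed.

Lemma linear_subset_sum (S T : set V) : linear_subset S -> linear_subset T ->
  linear_subset [set y + z | y in S & z in T].
Proof.
move=> [S0 SD] [T0 TD]; split; first by exists 0 => //; exists 0 => //; rewrite addr0.
move=> c _ _ [y Sy [z Tz <-]] [y' Sy' [z' Tz' <-]].
exists (c *: y + y'); first exact: SD.
by exists (c *: z + z'); [exact: TD | rewrite scalerDr addrACA].
Qed.

End LinearSpan.

Section ClosedSpan.
Context {R : realType} {X : completeNormedModType R}.
Implicit Types A S : set X.

Lemma closure_normP A y :
  closure A y <-> forall e : R, 0 < e -> exists2 a, A a & `|y - a| < e.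
Proof.
split=> [cAy e e0|Ay B].
  have [a [Aa /=]] := cAy (ball y e) (nbhsx_ballx y e e0).
  by rewrite -ball_normE; exists a.
rewrite -nbhs_ballE => -[e /= e0 eB]; have [a Aa ya] := Ay e e0.
by exists a; split=> //; apply: eB; rewrite -ball_normE.
Qed.

Lemma closure_linear S : linear_subset S -> linear_subset (closure S).
Proof.
move=> [S0 SD]; split=> [|c u v /closure_normP Su /closure_normP Sv].
  exact: subset_closure.
apply/closure_normP => e e0; have e20 : 0 < e / 2 by rewrite divr_gt0.
(* Adding 1 avoids a division by zero when [c] is 0. *)
have c0 : 0 < `|c| + 1 by rewrite ltr_wpDl.
have [u' Su' uu'] := Su (e / 2 / (`|c| + 1)) (divr_gt0 e20 c0).
have [v' Sv' vv'] := Sv _ e20.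
exists (c *: u' + v'); first exact: SD.
rewrite opprD addrACA -scalerBr [ltRHS](splitr e) (le_lt_trans (ler_normD _ _))//.
rewrite ler_ltD// normrZ; rewrite ltr_pdivlMr// in uu'.
by rewrite (le_trans _ (ltW uu'))// mulrC ler_wpM2l// lerDl.
Qed.

Lemma closed_span_linear A : linear_subset (closed_span A).
Proof. exact/closure_linear/linear_span_linear. Qed.

Lemma closed_closed_span A : closed (closed_span A).
Proof. exact: closed_closure. Qed.

Lemma sub_closed_span A : A `<=` closed_span A.
Proof. exact: subset_trans (@sub_linear_span _ _ _) (@subset_closure _ _). Qed.

Lemma closed_span_sub A S :
  linear_subset S -> closed S -> A `<=` S -> closed_span A `<=` S.
Proof.
move=> lS /closure_id cS AS; rewrite cS.
apply: closure_subset; exact: linear_span_sub.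
Qed.

Lemma closed_span_subset A A' : A `<=` A' -> closed_span A `<=` closed_span A'.
Proof. by move=> ?; apply: closure_subset; exact: linear_span_subset. Qed.

Definition rat_comb U (x : U -> X) (L : seq (rat * U)) : X :=
  \sum_(p <- L) ratr p.1 *: x p.2.

(** Approximate first by a real combination, then replace its coefficients by rationals one at a
    time, halving the error allowance at each step. *)
Lemma rat_comb_dense (U : eqType) (x : U -> X) (A : set U) y (e : R) : 0 < e ->
  closed_span (x @` A) y ->
  exists2 L, (forall p, p \in L -> A p.2) & `|y - rat_comb x L| < e.
Proof.
move=> e0 /closure_normP Ay; have e20 : 0 < e / 2 by rewrite divr_gt0.
have {Ay}[y' [n [c [v [Av ->{y'}]]]] yy'] := Ay _ e20.
suff [L LA Lc] : exists2 L, (forall p, p \in L -> A p.2) &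
    `|\sum_(i < n) c i *: v i - rat_comb x L| < e / 2.
  exists L => //; rewrite [ltRHS](splitr e).
  by rewrite (le_lt_trans (ler_distD (\sum_(i < n) c i *: v i) _ _))// ltrD.
have {}e20 := e20; move: (e / 2) e20 => {yy' e0}e e0.
elim: n c v Av e e0 => [|n IHn] c v Av e e0.
  by exists [::] => //; rewrite big_ord0 /rat_comb big_nil subrr normr0.
have e20 : 0 < e / 2 by rewrite divr_gt0.
have [u Au uv] := Av ord0.
have [L LA Lc] := IHn (c \o lift ord0) (v \o lift ord0) (fun=> Av _) _ e20.
have u0 : 0 < `|x u| + 1 by rewrite ltr_wpDl.
have [|r] := @rat_in_itvoo R (c ord0) (c ord0 + e / 2 / (`|x u| + 1)).
  by rewrite ltrDl divr_gt0.
rewrite in_itv/= => /andP[cr rc].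
exists ((r, u) :: L) => [p|].
  by rewrite in_cons => /predU1P[->|/LA].
rewrite big_ord_recl /rat_comb big_cons/= -uv opprD addrACA -scalerBl.
rewrite [ltRHS](splitr e) (le_lt_trans (ler_normD _ _))// ler_ltD//.
rewrite normrZ distrC gtr0_norm ?subr_gt0//.
rewrite -ltrBlDl ltr_pdivlMr// in rc.
by rewrite (le_trans _ (ltW rc))// ler_wpM2l ?subr_ge0 ?(ltW cr)// lerDl.
Qed.

End ClosedSpan.

(** * Selection of a subsequence; Hahn-Banach *)

(** Keeping [q] abstract treats the norm and the distance to a subspace at once. The cofinal set [A]
    lets every chosen term carry a further property that recurs arbitrarily far out. *)
Lemma tail_span_subsequence (R : realType) (X : completeNormedModType R)
    d (K : orderType d) (x : K -> X) (q : X -> R) (A : set K) :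
  regular_order K ->
  (forall u v, q u <= q v + `|u - v|) ->
  (forall y, exists b, forall z, tail_span x b z -> q y <= `|y + z|) ->
  (forall a, exists2 b, A b & (a <= b)%O) ->
  exists s : K -> K, [/\ {homo s : a b / (a < b)%O}, forall a, A (s a) &
    forall (D U : set K) y z, (forall a b, D a -> U b -> (a < b)%O) ->
      closed_span ((x \o s) @` D) y -> closed_span ((x \o s) @` U) z ->
      q y <= `|y + z|].
Proof.
move=> regK q_lip /choice[beta betaP] cofA.
have [wo _ small_seg] := regK.
(* The last clause puts the new index past the threshold [beta] of every rational combination of
   earlier terms; these form a small family, so such an index exists. *)
pose P l (f : K -> K) v := [/\ A v, forall a, (a < l)%O -> (f a < v)%O &
  forall L, (forall p, p \in L -> (p.2 < l)%O) ->
    (beta (rat_comb (x \o f) L) < v)%O].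
have [l f|l f g v fg [Av fv bv]|s sP] := @well_order_choice _ _ P wo.
- have [b1 b1P] := small_seg l f.
  have [b2 b2P] := small_lists regK (small_seg l) (beta \o rat_comb (x \o f)).
  have [v Av bv] := cofA (Order.max b1 b2); exists v.
  split=> // [a al|L Ll]; apply: lt_le_trans bv; rewrite lt_max.
    by rewrite b1P.
  by apply/orP; right; apply: b2P; apply/allP => p /Ll.
- split=> // [a al|L Ll]; first by rewrite -fg// fv.
  rewrite (_ : rat_comb _ L = rat_comb (x \o f) L); first exact: bv.
  by apply: eq_big_seq => p /Ll pl /=; rewrite fg.
exists s; split=> [a b ab|a|D U y z DU Dy Uz].
- by have [_ + _] := sP b; apply.
- by have [] := sP a.
(* Replace [y] by a rational combination [y'] over [D]: all of [U] is sent past [beta y'], and the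
   exchange costs the norm of [y - y'] twice. *)
apply/ler_addgt0Pr => e e0; have e20 : 0 < e / 2 by rewrite divr_gt0.
have [L LD Le] := rat_comb_dense e20 Dy.
set y' := rat_comb _ L in Le.
have tz : tail_span x (beta y') z.
  apply: closed_span_subset Uz => _ [b Ub <-]; exists (s b) => //=.
  by have [_ _] := sP b; apply => p /LD Dp; exact: DU.
rewrite (le_trans (q_lip y y'))// [in leRHS](splitr e) addrA.
rewrite lerD ?(ltW Le)// (le_trans (betaP _ _ tz))//.
have -> : y' + z = (y + z) + - (y - y') by rewrite opprB addrCA addrAC subrr add0r addrC.
by rewrite (le_trans (ler_normD _ _))// normrN lerD2l ltW.
Qed.

(** * Sublinear functionals and the Hahn-Banach theorem *)

Section HahnBanach.
Context {R : realType} {V : lmodType R}.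
Implicit Types p q : V -> R.

Definition sublinear q : Prop :=
  (forall u v, q (u + v) <= q u + q v) /\
  (forall c v, 0 <= c -> q (c *: v) = c * q v).

(** The reverse inequality is the given one for [c^-1] at the vector [c *: v]. *)
Lemma sublinearP q : q 0 = 0 -> (forall u v, q (u + v) <= q u + q v) ->
  (forall c v, 0 < c -> q (c *: v) <= c * q v) -> sublinear q.
Proof.
move=> q0 qD qZ; split=> // c v; rewrite le_eqVlt => /predU1P[<-|c0].
  by rewrite scale0r q0 mul0r.
apply/eqP; rewrite eq_le qZ//= -ler_pdivlMl//.
by rewrite -{1}[v](scalerK (lt0r_neq0 c0)) qZ ?invr_gt0.
Qed.

Lemma sublinear0 q : sublinear q -> q 0 = 0.
Proof. by move=> [_ qZ]; rewrite -(scale0r 0) qZ// mul0r. Qed.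

Lemma sublinear_ge_opp q v : sublinear q -> - q (- v) <= q v.
Proof.
move=> lq; have [qD _] := lq.
by rewrite lerNl -subr_ge0 opprK addrC -(sublinear0 lq) -(subrr v) qD.
Qed.

(** Let [r v] be the infimum of [q (v + t *: a) - t * q a] over t >= 0, finite because [- q (- v)]
    is a lower bound. Taking t = 0 gives r <= q; taking t = 1 at [- a] gives the last inequality. *)
Lemma sublinear_shift q a : sublinear q ->
  exists r, [/\ sublinear r, forall v, r v <= q v & r (- a) <= - q a].
Proof.
move=> lq; have [qD qZ] := lq.
pose S v := [set q (v + t *: a) - t * q a | t in [set t : R | 0 <= t]].
have lbS v : lbound (S v) (- q (- v)).
  move=> _ [t t0 <-]; rewrite lerBrDl lerBlDr -qZ//.
  by rewrite (le_trans _ (qD _ _))// addrAC subrr add0r.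
have hlbS v : has_lbound (S v) by exists (- q (- v)).
have S0 v : S v !=set0 by exists (q (v + 0 *: a) - 0 * q a); exists 0 => /=.
pose r v := inf (S v).
have rle v t : 0 <= t -> r v <= q (v + t *: a) - t * q a.
  by move=> t0; apply: ge_inf => //; exists t.
have rq v : r v <= q v by have := rle v 0 (lexx _); rewrite scale0r addr0 mul0r subr0.
exists r; split=> //; last first.
  have := rle (- a) 1 ler01.
  by rewrite scale1r mul1r addNr (sublinear0 lq) add0r.
apply: sublinearP => [|u v|c v c0].
- apply/eqP; rewrite eq_le -{1}(sublinear0 lq) rq/=.
  by apply: lb_le_inf => //; have := lbS 0; rewrite oppr0 (sublinear0 lq) oppr0.
- rewrite -lerBlDr; apply: lb_le_inf => // _ [t t0 <-].
  rewrite lerBlDr -lerBlDl; apply: lb_le_inf => // _ [t' t'0 <-].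
  rewrite lerBlDl (le_trans (rle _ _ (addr_ge0 t0 t'0)))//.
  by rewrite scalerDl addrACA mulrDl opprD [leRHS]addrACA lerD2r.
- rewrite -ler_pdivrMl//; apply: lb_le_inf => // _ [t t0 <-].
  rewrite ler_pdivrMl// mulrBr mulrA -qZ ?(ltW c0)// scalerDr scalerA.
  by apply: rle; rewrite mulr_ge0// ltW.
Qed.

(** The pointwise infimum works. For subadditivity, two members nearly optimal at [u] and at [v] are
    comparable, and the smaller one serves both vectors. *)
Lemma chain_inf_sublinear (p : V -> R) (F : set (V -> R)) : F !=set0 ->
  (forall q, F q -> sublinear q /\ forall v, q v <= p v) ->
  (forall q r, F q -> F r -> (forall v, q v <= r v) \/ (forall v, r v <= q v)) ->
  exists2 r, sublinear r & forall q, F q -> forall v, r v <= q v.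
Proof.
move=> [q0 Fq0] FP totF; pose S v := [set q v | q in F].
have hlbS v : has_lbound (S v).
  exists (- p (- v)) => _ [q /FP[lq qp] <-].
  by rewrite (le_trans _ (sublinear_ge_opp v lq))// lerN2.
have S0 v : S v !=set0 by exists (q0 v); exists q0.
pose r v := inf (S v).
have rle v q : F q -> r v <= q v by move=> Fq; apply: ge_inf => //; exists q.
exists r => [|q Fq v]; last exact: rle.
apply: sublinearP => [|u v|c v c0].
- apply/eqP; rewrite eq_le -{1}(sublinear0 (FP _ Fq0).1) rle//=.
  by apply: lb_le_inf => // _ [q /FP[lq _] <-]; rewrite (sublinear0 lq).
- rewrite -lerBlDr; apply: lb_le_inf => // _ [q Fq <-].
  rewrite lerBlDr -lerBlDl; apply: lb_le_inf => // _ [q' Fq' <-].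
  rewrite lerBlDl; have [qq'|q'q] := totF _ _ Fq Fq'.
    by rewrite (le_trans (rle _ _ Fq))// (le_trans ((FP _ Fq).1.1 _ _))// lerD2l.
  by rewrite (le_trans (rle _ _ Fq'))// (le_trans ((FP _ Fq').1.1 _ _))// lerD2r.
- rewrite -ler_pdivrMl//; apply: lb_le_inf => // _ [q Fq <-].
  by rewrite ler_pdivrMl// -(FP _ Fq).1.2 ?(ltW c0)// rle.
Qed.

(* A minimal sublinear functional q is additive, since q_a v := inf_t q (v + t a) - t q a
   (see sublinear_shift) is sublinear and lies below q, hence equals q. *)
Lemma hahn_banach p a : sublinear p ->
  exists f : V -> R^o, [/\ linear f, forall v, f v <= p v & f a = p a].
Proof.
(* Starting from [p1] secures the value at [a]: a linear f below [p1] has - f a = f (- a) <= - p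
   a. *)
move=> lp; have [p1 [lp1 p1p p1a]] := sublinear_shift a lp.
pose T := {q : V -> R | sublinear q /\ forall v, q v <= p1 v}.
(* The order is reversed, so that a maximal element for Zorn is a minimal functional. *)
pose le (q r : T) := `[< forall v, sval r v <= sval q v >].
have [||C totC|[q [lq qp1]] qmin] :=
  @ZL_preorder T (exist _ p1 (conj lp1 (fun=> lexx _))) le.
- by move=> q; apply/asboolP.
- move=> r q t /asboolP rq /asboolP qt; apply/asboolP => v.
  exact: le_trans (qt v) (rq v).
- have [->|/set0P C0] := eqVneq C set0.
    by exists (exist _ p1 (conj lp1 (fun=> lexx _))) => ? [].
  have [|_ [[q ?] _ <-]//|_ _ [q Cq <-] [r Cr <-]|r lr rF] :=
      @chain_inf_sublinear p1 [set sval q | q in C].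
  + by case: C0 => q Cq; exists (sval q); exists q.
  + by case: (totC _ _ Cq Cr) => /asboolP; [right|left].
  have rp1 v : r v <= p1 v.
    case: C0 => q Cq; apply: le_trans ((svalP q).2 v).
    by apply: rF; exists q.
  exists (exist _ r (conj lr rp1)) => q Cq; apply/asboolP => v /=.
  by apply: rF; exists q.
have qD u v : q (u + v) = q u + q v.
  apply/eqP; rewrite eq_le lq.1/=.
  have [r [lr rq rv]] := sublinear_shift (- u) lq.
  have rp1 w : r w <= p1 w by exact: le_trans (rq w) (qp1 w).
  have /qmin/asboolP/= qr : le (exist _ q (conj lq qp1)) (exist _ r (conj lr rp1)).
    exact/asboolP.
  have qu : q u <= - q (- u) by rewrite opprK in rv; exact: le_trans rv.
  rewrite [leLHS]addrC (le_trans (_ : _ <= q v - q (- u)))// ?lerD2l//.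
  by rewrite lerBlDr (le_trans _ (lq.1 _ _))// addrAC subrr add0r.
have q0 := sublinear0 lq.
have qN v : q (- v) = - q v.
  by apply/eqP; rewrite -addr_eq0 -qD addNr q0.
exists q; split.
- move=> c u v; rewrite qD; congr (_ + _).
  have [c0|c0] := leP 0 c; first by rewrite lq.2.
  by rewrite -{1}[c]opprK scaleNr qN lq.2 ?oppr_ge0 ?(ltW c0)// mulNr opprK.
- by move=> v; exact: le_trans (qp1 v) (p1p v).
- apply/eqP; rewrite eq_le (le_trans (qp1 a) (p1p a))/=.
  by rewrite -lerN2 -qN (le_trans (qp1 _)).
Qed.

End HahnBanach.

(** * Distance to a subspace; dual functionals *)

Section Distance.
Context {R : realType} {X : completeNormedModType R}.
Variables (W : set X) (lW : linear_subset W).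

(** For a subspace [W] this is the quotient seminorm; the sign of [z] is then immaterial. *)
Definition dist_to (y : X) : R := inf [set `|y + z| | z in W].

Lemma dist_to_le y z : W z -> dist_to y <= `|y + z|.
Proof.
by move=> Wz; apply: ge_inf; [exists 0 => _ [? _ <-] | exists z].
Qed.

Lemma dist_to_ge y r : (forall z, W z -> r <= `|y + z|) -> r <= dist_to y.
Proof.
move=> rW; apply: lb_le_inf => [|_ [z Wz <-]]; last exact: rW.
by exists `|y + 0|; exists 0 => //; case: lW.
Qed.

Lemma dist_to_ge0 y : 0 <= dist_to y.
Proof. exact: dist_to_ge. Qed.

Lemma dist_to_le_norm y : dist_to y <= `|y|.
Proof. by rewrite -[y in leRHS]addr0; apply: dist_to_le; case: lW. Qed.

Lemma dist_to_eq0 y : W y -> dist_to y = 0.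
Proof.
move=> Wy; apply/eqP; rewrite eq_le dist_to_ge0 andbT.
by have := dist_to_le y (linear_subsetN lW Wy); rewrite subrr normr0.
Qed.

Lemma dist_to_sublinear : sublinear dist_to.
Proof.
apply: sublinearP => [|u v|c v c0].
- by rewrite dist_to_eq0//; case: lW.
- rewrite -lerBlDr; apply: dist_to_ge => z Wz.
  rewrite lerBlDr -lerBlDl; apply: dist_to_ge => z' Wz'.
  rewrite lerBlDl (le_trans (dist_to_le _ (linear_subsetD lW Wz Wz')))//.
  by rewrite addrACA ler_normD.
- rewrite -ler_pdivrMl//; apply: dist_to_ge => z Wz.
  rewrite ler_pdivrMl// -[X in X * _](gtr0_norm c0) -normrZ scalerDr.
  by apply: dist_to_le; apply: linear_subsetZ.
Qed.

Lemma dist_toN y : dist_to (- y) = dist_to y.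
Proof.
suff H v : dist_to (- v) <= dist_to v.
  by apply/eqP; rewrite eq_le H -{1}[y]opprK H.
apply: dist_to_ge => z Wz; rewrite -normrN opprD; apply: dist_to_le.
exact: linear_subsetN.
Qed.

Lemma dist_to_lipschitz u v : dist_to u <= dist_to v + `|u - v|.
Proof.
rewrite -[u in leLHS](subrK v) addrC (le_trans (dist_to_sublinear.1 _ _))//.
by rewrite lerD2l dist_to_le_norm.
Qed.

Lemma dist_to_eq0_closed y : closed W -> dist_to y = 0 -> W y.
Proof.
move=> /closure_id cW y0; rewrite cW; apply/closure_normP => e e0.
apply: contrapT => nW; suff : e <= dist_to y by rewrite y0 leNgt e0.
apply: dist_to_ge => z Wz; rewrite leNgt; apply/negP => yz; apply: nW.
by exists (- z); rewrite ?opprK//; exact: linear_subsetN.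
Qed.

End Distance.

Section Dual.
Context {R : realType} {X : completeNormedModType R}.
Implicit Type f : X -> R^o.

Lemma linear_functionN f : linear f -> forall v, f (- v) = - f v.
Proof.
move=> lf v; pose F := GRing.isLinear.Build R X R^o _ f lf.
pose g : {linear X -> R^o} := HB.pack f F.
exact: (linearN g).
Qed.

Lemma linear_norm_le f M : linear f -> (forall v, f v <= M * `|v|) ->
  forall v, `|f v| <= M * `|v|.
Proof.
move=> lf fM v; rewrite ler_norml fM andbT lerNl -linear_functionN//.
by rewrite -(normrN v) fM.
Qed.

Lemma dual_of_le f M : linear f -> (forall v, f v <= M * `|v|) -> dual f.
Proof.
move=> lf /(linear_norm_le lf) fM; split=> //.
pose F := GRing.isLinear.Build R X R^o _ f lf.
pose g : {linear X -> R^o} := HB.pack f F.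
apply/(linear_bounded_continuous g)/linear_boundedP; near=> r => v.
by rewrite (le_trans (fM v))// ler_wpM2r.
Unshelve. all: by end_near. Qed.

Lemma dual_norm_le f M : 0 <= M -> (forall v, `|f v| <= M * `|v|) -> dual_norm f <= M.
Proof.
move=> M0 fM; apply: ge_sup.
  by exists `|f 0|; exists 0 => //=; rewrite normr0.
move=> _ [v /= v1 <-]; rewrite (le_trans (fM v))// -[leRHS]mulr1.
exact: ler_wpM2l.
Qed.

Lemma kernel_linear f : linear f -> linear_subset [set v | f v = 0].
Proof.
move=> lf; split=> [|c u v /= fu fv]; last by rewrite lf fu fv scaler0 addr0.
have := lf (-1) 0 0; rewrite scaler0 addr0 scaleN1r addNr.
by [].
Qed.

Lemma dual_closed_span_eq0 f (A : set X) : dual f -> (forall v, A v -> f v = 0) ->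
  forall v, closed_span A v -> f v = 0.
Proof.
move=> [lf cf] fA; apply: closed_span_sub => //; first exact: kernel_linear.
apply: (@preimage_closed _ _ f [set 0]) => [v _|]; first exact: cf.
exact: closed_eq.
Qed.

End Dual.

(** * Sequences indexed by a regular cardinal *)

Section RegularSequences.
Context {R : realType} {X : completeNormedModType R}.
Context {d : Order.disp_t} {K : orderType d}.
Hypothesis regK : regular_order K.
Implicit Type x : K -> X.

(** Uncountable cofinality enters here: thresholds for the tolerances 1/(n+1) merge into a single
    one valid for all n. *)
Lemma regular_bound (b : nat -> K) : exists c, forall n, (b n < c)%O.
Proof.
have [_ small_countable _] := regK.
have [//|c bc] := @small_countable nat [set: nat] _ b.
by exists c => n; exact: bc.
Qed.

Lemma regular_inhabited : exists b : K, True.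
Proof.
have [_ small_countable _] := regK.
by have [b _] := @small_countable K set0 (countable0 _) id; exists b.
Qed.

Lemma ler_add_invr (r s : R) : (forall n : nat, r <= s + n.+1%:R^-1) -> r <= s.
Proof.
move=> rs; rewrite leNgt; apply/negP => /ltr_add_invr[n].
by rewrite ltNge rs.
Qed.

Lemma invS_gt0 n : 0 < n.+1%:R^-1 :> R.
Proof. by rewrite invr_gt0. Qed.

Lemma tail_spanS x a b : (a <= b)%O -> tail_span x b `<=` tail_span x a.
Proof.
move=> ab; apply: closed_span_subset; apply: image_subset => c /=.
exact: le_lt_trans.
Qed.

(** Beyond a common index all the functionals f_n with error 1/(n+1) kill the tail span, so f_n y =
    f_n (y + z), which is at most the norm of [y + z]. *)
Lemma norm_le_tail x y :
  (forall e, 0 < e -> exists f, [/\ dual f, forall v, f v <= `|v|,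
     `|y| - e < f y & exists b, forall a, (b < a)%O -> f (x a) = 0]) ->
  exists b, forall z, tail_span x b z -> `|y| <= `|y + z|.
Proof.
move=> fP; have [f {}fP] := choice (fun n => fP _ (invS_gt0 n)).
have /choice[b bP] : forall n, exists b, forall a, (b < a)%O -> f n (x a) = 0.
  by move=> n; have [] := fP n.
have [c bc] := regular_bound b.
exists c => z cz; apply: ler_add_invr => n.
have [df fle fy _] := fP n; rewrite -lerBlDr (le_trans (ltW fy))//.
have fz : f n z = 0.
  apply: dual_closed_span_eq0 (df) _ _ cz => _ [a /= ca <-].
  by apply: bP; exact: lt_trans (bc n) ca.
have -> : f n y = f n (y + z) by have [lf _] := df; rewrite -[y in RHS]scale1r lf fz addr0 scale1r.
exact: fle.
Qed.

(** Hahn-Banach gives a functional norming [y] exactly. Its values along [x] tend to 0, and merging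
    the thresholds for all 1/(n+1) makes them eventually equal to 0. *)
Lemma weakly_null_tail x y : weakly_null x ->
  exists b, forall z, tail_span x b z -> `|y| <= `|y + z|.
Proof.
move=> x0; apply: norm_le_tail => e e0.
have lN : sublinear (fun v : X => `|v|).
  split=> [u v|c v c0]; first exact: ler_normD.
  by rewrite normrZ ger0_norm.
have [f [lf fle fy]] := hahn_banach y lN.
have df : dual f.
  by apply: (dual_of_le (M := 1)) => // v; rewrite mul1r.
exists f; split=> //; first by rewrite fy gtrBl.
have /choice[b bP] : forall n : nat,
    exists b, forall a, (b <= a)%O -> `|f (x a)| < n.+1%:R^-1.
  move=> n.
  have [b _ bP] := x0 f df _ (nbhsx_ballx (0 : R^o) _ (invS_gt0 n)).
  exists b => a ba; have := bP a ba.
  by rewrite /= -ball_normE /= sub0r normrN.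
have [c bc] := regular_bound b.
exists c => a ca; apply/eqP; rewrite -normr_eq0 eq_le normr_ge0 andbT.
apply: ler_add_invr => n; rewrite add0r ltW// bP//.
by rewrite ltW// (lt_trans (bc n)).
Qed.

Lemma convex_ball_tail x y r b : convex_set
  ([set v | `|y + v| <= r /\ tail_span x b v] : set (convex_lmodType X)).
Proof.
apply/convex_setW => u v; rewrite !inE /= => -[yu xu] [yv xv] k k0 k1.
have -> : conv k u v = k%:num *: (u : X) + (1 - k%:num) *: (v : X) by [].
rewrite inE /=; split; last first.
  have [_ SD] := closed_span_linear (x @` [set a | (b < a)%O]).
  by apply: SD => //; exact: linear_subsetZ (closed_span_linear _) xv.
have -> : y + (k%:num *: (u : X) + (1 - k%:num) *: (v : X)) =
    k%:num *: (y + u) + (1 - k%:num) *: (y + v).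
  by rewrite !scalerDr addrACA -scalerDl (addrC k%:num) subrK scale1r.
rewrite (le_trans (ler_normD _ _))// !normrZ.
rewrite (gtr0_norm k0) gtr0_norm ?subr_gt0//.
have -> : r = k%:num * r + (1 - k%:num) * r by rewrite -mulrDl addrC subrK mul1r.
by rewrite lerD// ler_wpM2l ?subr_ge0// ltW.
Qed.

Lemma closed_ball_tail x (y : X) r b :
  closed [set v | `|y + v| <= r /\ tail_span x b v].
Proof.
apply: closedI; last exact: closed_closed_span.
apply: (@preimage_closed _ _ (fun v => `|y + v|) [set s | s <= r]).
  move=> v _; apply: continuous_comp; last exact: norm_continuous.
  exact: (cvgD (cvg_cst _) cvg_id).
exact: closed_le.
Qed.

Definition tail_core x : set X := \bigcap_(b in [set: K]) tail_span x b.

Lemma tail_core_linear x : linear_subset (tail_core x).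
Proof.
split=> [b _|c u v xu xv b _]; first exact: (closed_span_linear _).1.
by apply: (closed_span_linear _).2; [exact: xu | exact: xv].
Qed.

Lemma closed_tail_core x : closed (tail_core x).
Proof. by apply: closed_bigI => b _; exact: closed_closed_span. Qed.

Lemma property_C_tail x y : property_C X ->
  exists b, forall z, tail_span x b z -> dist_to (tail_core x) y <= `|y + z|.
Proof.
move=> pC; set D := dist_to _ y.
suff /choice[b bP] : forall n : nat,
    exists b, forall z, tail_span x b z -> D <= `|y + z| + n.+1%:R^-1.
  have [c bc] := regular_bound b; exists c => z cz.
  apply: ler_add_invr => n; apply: bP.
  exact: tail_spanS (ltW (bc n)) _ cz.
move=> n; have e0 := invS_gt0 n; move: (n.+1%:R^-1) e0 => e e0.
pose B b := [set v | `|y + v| <= D - e /\ tail_span x b v].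
have [A [b _ <-]||G [GF cG G0]] := pC (range B).
- by split; [exact: closed_ball_tail | exact: convex_ball_tail].
- apply/seteqP; split=> // v Bv.
  (* A common point [v] would lie in the intersection of all tail spans, hence satisfy both this
     bound and the bound [D - e]. *)
  have : D <= `|y + v|.
    by apply: dist_to_le => b _; have [] := Bv (B b) (imageT _ _).
  have [b0 _] := regular_inhabited.
  have [yv _] := Bv (B b0) (imageT _ _).
  by rewrite leNgt (le_lt_trans yv)// gtrBl.
(* [beta] recovers an index for each member of the countable subfamily; a bound [c] for these
   indices places every later tail span inside all the tail spans involved. *)
have /choice[beta betaP] : forall A, exists b, G A -> A = B b.
  move=> A; have [GA|nGA] := pselect (G A).
    by have [b _ <-] := GF A GA; exists b.
  by have [b _] := regular_inhabited; exists b => /nGA.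
have [_ small_countable _] := regK.
have [c bc] := small_countable _ _ cG beta.
exists c => z cz; rewrite leNgt; apply/negP; rewrite -ltrBrDr => Dz.
suff : (set0 : set X) z by [].
rewrite -G0 => A GA; rewrite (betaP A GA); split; first exact: ltW.
exact: tail_spanS (ltW (bc A GA)) _ cz.
Qed.

Lemma monotone_subsequence x : (forall a, x a != 0) ->
  (forall y, exists b, forall z, tail_span x b z -> `|y| <= `|y + z|) ->
  has_subsequence (fun y => monotone_basic_sequence y) x.
Proof.
move=> x0 xtail.
have [u v||s [smono _ sP]] := tail_span_subsequence (A := setT) regK _ xtail.
- by rewrite -[u in leLHS](subrK v) addrC ler_normD.
- by move=> a; exists a.
exists s; split=> //; split=> [a|l y z yD zU]; first exact: x0.
rewrite mul1r; apply: sP yD zU => a b /=; exact: lt_le_trans.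
Qed.

(** Otherwise the distances fall eventually below each 1/(n+1), hence are 0 past some [c]. Then the
    tail span at [c] is contained in the core, against the strict inclusion. *)
Lemma dispersed_dist x : dispersed x -> exists2 e : R, 0 < e &
  forall a, exists2 b, e <= dist_to (tail_core x) (x b) & (a <= b)%O.
Proof.
move=> dx; apply: contrapT => nex.
have /choice[b bP] : forall n : nat, exists b, forall a, (b <= a)%O ->
    dist_to (tail_core x) (x a) < n.+1%:R^-1.
  move=> n; apply: contrapT => nb; apply: nex; exists n.+1%:R^-1; first exact: invS_gt0.
  move=> b; apply: contrapT => nc; apply: nb; exists b => a ba.
  by rewrite ltNge; apply/negP => xa; apply: nc; exists a.
have [c bc] := regular_bound b.
have [_ []] := dx c; apply: closed_span_sub; [|exact: closed_tail_core|].
  exact: tail_core_linear.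
move=> _ [a /= ca <-].
apply: dist_to_eq0_closed; [exact: tail_core_linear|exact: closed_tail_core|].
apply/eqP; rewrite eq_le (dist_to_ge0 (tail_core_linear x)) andbT.
apply: ler_add_invr => n; rewrite add0r ltW// bP// ltW//.
exact: lt_trans (bc n) ca.
Qed.

End RegularSequences.

(** * Bounded biorthogonal functionals from distance estimates *)

Section Biorthogonal.
Context {R : realType} {X : completeNormedModType R}.

(** A linear functional dominated by the distance to the span of the other terms vanishes on that
    span. Hahn-Banach lets it attain the distance at [u a], and dividing by that distance gives norm
    at most [e^-1]. *)
Lemma bounded_biorthogonal_of_dist (I : eqType) (u : I -> X) (e : R) : 0 < e ->
  (forall a, `|u a| = 1) ->
  (forall a, e <= dist_to (linear_span (u @` [set b | b != a])) (u a)) ->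
  bounded_biorthogonal_sequence u.
Proof.
move=> e0 u1 ue.
have /choice[xs xsP] : forall a, exists f : X -> R^o, [/\ dual f,
    forall b, f (u b) = (a == b)%:R & forall v, `|f v| <= e^-1 * `|v|].
  move=> a; pose W := linear_span (u @` [set b | b != a]).
  have lW : linear_subset W by exact: linear_span_linear.
  pose r := dist_to W (u a); have r0 : 0 < r by exact: lt_le_trans (ue a).
  have [f [lf fle fa]] := hahn_banach (u a) (dist_to_sublinear lW).
  pose g : X -> R^o := fun v => r^-1 * f v.
  have lg : linear g.
    by move=> c v w; rewrite /g lf mulrDr mulrCA.
  have gle v : g v <= e^-1 * `|v|.
    rewrite /g ler_pdivrMl// mulrA (le_trans (fle v))//.
    rewrite (le_trans (dist_to_le_norm lW v))// -[leLHS]mul1r ler_wpM2r//.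
    by rewrite ler_pdivlMr// mul1r; exact: ue.
  exists g; split; [exact: dual_of_le gle| |exact: linear_norm_le].
  move=> b; have [<-|ab] := eqVneq a b.
    by rewrite /g fa mulVf ?gt_eqF.
  have Wb : W (u b).
    by apply: sub_linear_span; exists b => //=; rewrite eq_sym.
  suff fb : f (u b) = 0 by rewrite /g fb mulr0.
  have := fle (u b); have := fle (- u b).
  rewrite (linear_functionN lf) (dist_toN lW) (dist_to_eq0 lW Wb) oppr_le0 => fb0 fb1.
  by apply/eqP; rewrite eq_le fb0 fb1.
exists xs; first by split=> [a|a b]; have [] := xsP a.
exists e^-1 => a; rewrite u1 mul1r; apply: dual_norm_le; first by rewrite invr_ge0 ltW.
by have [] := xsP a.
Qed.

(* The sums y and y + u a of an initial segment both control the norm of y + u a + z. *)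
Lemma dist_to_others d (K : orderType d) (u : K -> X) (W : set X) a :
  linear_subset W ->
  (forall (D U : set K) y z, (forall a b, D a -> U b -> (a < b)%O) ->
     closed_span (u @` D) y -> closed_span (u @` U) z ->
     dist_to W y <= `|y + z|) ->
  dist_to W (u a) / 2 <= dist_to (linear_span (u @` [set b | b != a])) (u a).
Proof.
move=> lW uW; apply: dist_to_ge => [|w]; first exact: linear_span_linear.
have lD (D : set K) := closed_span_linear (u @` D).
have sD (D : set K) b : D b -> closed_span (u @` D) (u b).
  by move=> Db; apply: sub_closed_span; exists b.
move=> /(linear_span_sub (linear_subset_sum (lD [set b | (b < a)%O]) (lD [set b | (a < b)%O])))[].
  move=> _ [b /= ba <-]; have [ab|ab|ab] := ltgtP a b.
  - by exists 0; [exact: (lD _).1 | exists (u b); [exact: sD | rewrite add0r]].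
  - by exists (u b); [exact: sD | exists 0; [exact: (lD _).1 | rewrite addr0]].
  - by rewrite ab eqxx in ba.
move=> y yS [z zS <-].
have yle : dist_to W y <= `|y + (u a + z)|.
  apply: (uW [set b | (b < a)%O] [set b | (a <= b)%O]) yS _ => [b c /=|].
    exact: lt_le_trans.
  apply: linear_subsetD (lD _) _ _; first by apply: sD => /=.
  by apply: closed_span_subset zS; apply: image_subset => b /ltW.
have yale : dist_to W (u a + y) <= `|(u a + y) + z|.
  apply: (uW [set b | (b <= a)%O] [set b | (a < b)%O]) _ zS => [b c /=|].
    exact: le_lt_trans.
  apply: linear_subsetD (lD _) _ _; first by apply: sD => /=.
  by apply: closed_span_subset yS; apply: image_subset => b /ltW.
rewrite ler_pdivrMr// mulr_natr mulr2n.
(* Writing [u a] as (u a + y) - y uses both estimates at once, which is where the factor 2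
   arises. *)
have ule := (dist_to_sublinear lW).1 (u a + y) (- y).
rewrite addrK (dist_toN lW) in ule; rewrite (le_trans ule)// lerD//.
  by rewrite addrA.
by rewrite addrCA.
Qed.

Lemma bounded_biorthogonal_subsequence d (K : orderType d) (x : K -> X) :
  regular_order K -> property_C X -> (forall a, `|x a| = 1) -> dispersed x ->
  has_subsequence (fun y => bounded_biorthogonal_sequence y) x.
Proof.
move=> regK pC x1 dx; have lx := tail_core_linear x.
have [e e0 xe] := dispersed_dist regK dx.
(* The cofinal set here consists of the indices whose terms stay at distance at least [e] from the
   core. *)
have [s [smono se sP]] := tail_span_subsequence regK
  (dist_to_lipschitz lx) (fun y => property_C_tail regK x y pC) xe.
exists s; split=> //.
apply: (@bounded_biorthogonal_of_dist _ _ (e / 2)) => [|a|a]; first by rewrite divr_gt0.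
- exact: x1.
- apply: le_trans (dist_to_others a lx sP).
  by rewrite ler_pM2r ?invr_gt0//; exact: se.
Qed.

End Biorthogonal.

(** * Plichko spaces *)

(** Well-orders are given by least elements alone; inspect the least element of {a, b, c}, where
    antisymmetry settles the cases [b] and [c]. *)
Lemma well_order_trans (T : eqType) (r : rel T) :
  wochoice.well_order r -> transitive r.
Proof.
move=> wo; have rch := wochoice.withinW (A := predT) wo.
have rtotal := wochoice.wo_chainW rch.
have ranti := wochoice.wo_chain_antisymmetric rch.
move=> b a c ab bc.
have [|m [[mabc mle] _]] := wo (fun i => i \in [:: a; b; c]).
  by exists a; rewrite unfold_in mem_head.
have [ma mb mc] : [/\ r m a, r m b & r m c].
  by split; apply: mle; rewrite unfold_in !inE eqxx ?orbT.
move: mabc; rewrite unfold_in !inE => /or3P[] /eqP mE; rewrite {}mE in ma mb mc => //.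
- by rewrite (ranti a b) // ab.
- by rewrite -(ranti b c) // bc.
Qed.

(** * Subsets of a well-ordered type as ordered types *)

Section Segment.
Context {I : eqType} {r : rel I} (wo : wochoice.well_order r) (P : pred I).

(* The phantom well-order proof is what the order instance below is keyed on. *)
Definition segment & wochoice.well_order r : Type := {i : I | P i}.
Local Notation T := (segment wo).

HB.instance Definition _ := Equality.on T.
HB.instance Definition _ := gen_choiceMixin T.

Definition segment_le (a b : T) := r (sval a) (sval b).

Let wo_predT : wochoice.wo_chain r predT := wochoice.withinW wo.

Lemma segment_le_total : total segment_le.
Proof. by move=> a b; exact: wochoice.wo_chainW wo_predT _ _ isT isT. Qed.

Lemma segment_le_anti : antisymmetric segment_le.
Proof.
move=> a b ab; apply: val_inj.
exact: wochoice.wo_chain_antisymmetric wo_predT _ _ isT isT ab.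
Qed.

Lemma segment_le_refl : reflexive segment_le.
Proof. by move=> a; have := segment_le_total a a; rewrite orbb. Qed.

Lemma segment_le_trans : transitive segment_le.
Proof. by move=> b a c; exact: well_order_trans wo _ _ _. Qed.

HB.instance Definition _ := Order.Le_isPOrder.Build Order.default_display T
  segment_le_refl segment_le_anti segment_le_trans.
HB.instance Definition _ := Order.POrder_isTotal.Build Order.default_display T
  segment_le_total.

Lemma segment_well_order : wochoice.well_order (<=%O : rel T).
Proof.
apply: wochoice.antisymmetric_well_order; first exact: segment_le_anti.
move=> A [a Aa].
have [|m [[/asboolP[b Ab bm] mle] _]] := @wo (fun i => `[< exists2 b, b \in A & sval b = i >]).
  by exists (sval a); apply/asboolP; exists a.
exists b; split=> // c Ac; rewrite -[(_ <= _)%O]/(r (sval b) (sval c)) bm.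
by apply: mle; apply/asboolP; exists c.
Qed.

End Segment.

Lemma countable_preimage_inj T U (f : T -> U) (A : set U) : injective f ->
  countable A -> countable (f @^-1` A).
Proof.
move=> finj /countable_injP[g ginj]; apply/countable_injP; exists (g \o f) => a b.
by rewrite !inE => Aa Ab /ginj fab; apply: finj; apply: fab; rewrite inE.
Qed.

Definition omega1_like d (T : orderType d) : Prop :=
  [/\ wochoice.well_order (<=%O : rel T), ~ countable [set: T] &
      forall a : T, countable [set b | (b < a)%O]].

(** Well-order [I]. If some element has uncountably many predecessors, cut at the least such
    element; otherwise keep all of [I]. *)
Lemma omega1_likeP (I : eqType) : ~ countable [set: I] ->
  exists d (T : orderType d) (g : T -> I), injective g /\ omega1_like T.
Proof.
move=> ncI; have [r wo] := wochoice.well_ordering_principle I.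
have rtotal : total r.
  by move=> i j; exact: wochoice.wo_chainW (wochoice.withinW (A := predT) wo) _ _ isT isT.
have ranti : antisymmetric r.
  by move=> i j; exact: wochoice.wo_chain_antisymmetric (wochoice.withinW (A := predT) wo) _ _ isT isT.
pose below i := [set j | ~~ r i j].
have [P [ncP cP]] : exists P : pred I, ~ countable [set i | P i] /\
    forall i, P i -> countable (below i `&` [set i | P i]).
  have [[i nci]|cbelow] := pselect (exists i, ~ countable (below i)); last first.
    exists predT; split=> [|i _]; first by rewrite (_ : [set _ | _] = setT)//; apply/seteqP.
    apply: contrapT => nci; apply: cbelow; exists i => ci; apply: nci.
    exact: sub_countable (subset_card_le (@subIsetl _ _ _)) ci.
  have [|m [[/asboolP ncm mle] _]] := wo (fun i => `[< ~ countable (below i) >]).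
    by exists i; apply/asboolP.
  exists (fun j => ~~ r m j); split=> // j nrmj.
  apply: contrapT => ncj; case/negP: nrmj; apply: mle; apply/asboolP => cj.
  by apply: ncj; apply: sub_countable (subset_card_le (@subIsetl _ _ _)) cj.
exists _, (segment P wo), sval; split; first exact: val_inj.
split; first exact: segment_well_order.
- move=> cT; apply: ncP.
  rewrite (_ : [set i | P i] = range (sval : segment P wo -> I)).
    exact: sub_countable (card_image_le _ _) cT.
  by apply/seteqP; split=> [i Pi|_ [[i Pi] _ <-]//]; exists (exist _ i Pi).
- move=> a; apply: sub_countable (countable_preimage_inj (@val_inj _ _ _) (cP _ (svalP a))).
  apply: subset_card_le => b; rewrite /= ltNge => ba; split; last exact: (svalP b).
  exact: ba.
Qed.

Section Omega1.
Context {d : Order.disp_t} {T : orderType d}.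
Hypothesis TO : omega1_like T.

Lemma omega1_like_countable_le (a : T) : countable [set b | (b <= a)%O].
Proof.
have [_ _ cT] := TO.
rewrite (_ : mkset _ = \bigcup_(i in [set: bool])
    (if i then [set b | (b < a)%O] else [set a])).
  by apply: bigcup_countable => // -[_|_]; [exact: cT | exact: countable1].
apply/seteqP; split=> [b /=|b [[|] _ /=]]; last by move=> ->.
  by rewrite le_eqVlt => /predU1P[->|ba]; [exists false | exists true].
exact: ltW.
Qed.

(** If a map from a countable set were unbounded, countably many countable initial segments would
    cover [T]. *)
Lemma omega1_like_regular : regular_order T.
Proof.
have [wo ncT cT] := TO.
have csmall U (A : set U) : countable A -> small T A.
  move=> cA g; apply: contrapT => /forallNP gub; apply: ncT.
  apply: (@sub_countable _ _ _ (\bigcup_(u in A) [set b | (b <= g u)%O])).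
    apply: subset_card_le => b _; have /existsNP[u /not_implyP[Au /negP]] := gub b.
    by rewrite -leNgt; exists u.
  by apply: bigcup_countable => // u _; exact: omega1_like_countable_le.
by split=> // a; exact: csmall.
Qed.

Lemma omega1_like_limit : limit_ordinal T.
Proof.
have [wo ncT _] := TO; split=> // [|a].
  by have [b _] := regular_inhabited omega1_like_regular; exists b.
apply: contrapT => /forallNP amax; apply: ncT.
rewrite (_ : setT = [set b | (b <= a)%O]); first exact: omega1_like_countable_le.
by apply/seteqP; split=> // b _ /=; rewrite leNgt; apply/negP/amax.
Qed.

End Omega1.

Section Plichko.
Context {R : realType} {X : completeNormedModType R}.

Lemma separable_closed_span (I : eqType) (x : I -> X) :
  closed_span (range x) = setT -> countable [set: I] -> separable X.
Proof.
move=> xX /countable_injP[h hinj].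
exists (range (rat_comb x)).
  apply: sub_countable (card_image_le _ _) _; apply/countable_injP.
  exists (pickle \o map (fun p => (p.1, h p.2))) => L L' _ _ /(pcan_inj pickleK).
  apply: inj_map => -[a i] [b j] [-> hij]; congr (_, _).
  by apply: hinj; rewrite ?inE.
move=> O [v Ov] oO; have /nbhs_ballP[e /= e0 eO] := open_nbhs_nbhs (conj oO Ov).
have [|L _ Le] := @rat_comb_dense _ _ _ x setT v e e0; first by rewrite xX.
by exists (rat_comb x L); split; [apply: eO; rewrite -ball_normE | exists L].
Qed.

Lemma dual_norm1_le (f : X -> R^o) v : linear f -> dual_norm f = 1 -> f v <= `|v|.
Proof.
move=> lf f1.
(* The dual norm is 1, not the default 0 of [sup], so the supremum is a genuine one. *)
have hs : has_sup [set `|f x| | x in [set x | `|x| <= 1]].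
  apply: contrapT => /sup_out; rewrite -/(dual_norm f) f1 => /eqP.
  by rewrite oner_eq0.
have [->|v0] := eqVneq v 0.
  by rewrite normr0; have [-> _] := kernel_linear lf.
have nv0 : 0 < `|v| by rewrite normr_gt0.
have fvle : `|f (`|v|^-1 *: v)| <= 1.
  rewrite -f1; apply: (ub_le_sup hs.2); exists (`|v|^-1 *: v) => //=.
  by rewrite normrZ normfV normr_id mulVf ?gt_eqF.
have := le_trans (ler_norm _) fvle.
rewrite -[_ *: v]addr0 lf (kernel_linear lf).1 addr0.
by rewrite -[_ *: f v]/(_ * f v) ler_pdivrMl// mulr1.
Qed.

Lemma plichko_monotone_basic : ~ separable X -> plichko X ->
  exists (d : Order.disp_t) (T : orderType d) (x : T -> X),
    [/\ limit_ordinal T, ~ countable [set: T] & monotone_basic_sequence x].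
Proof.
move=> nsep [I [x [xs [[[dxs xsx] xX _] norming]]]].
have ncI : ~ countable [set: I] by move/(separable_closed_span xX).
have [d [T [g [ginj TO]]]] := omega1_likeP ncI.
have regT := omega1_like_regular TO.
have [||s [_ sbasic]] := @monotone_subsequence _ _ _ _ regT (x \o g).
- move=> a /=; apply/eqP => xa0; have /eqP := xsx (g a) (g a).
  by rewrite xa0 eqxx (kernel_linear (dxs _).1).1 eq_sym oner_eq0.
- move=> y; apply: norm_le_tail => // e e0.
  (* The supremum is the norm of [y], hence finite, so some countably supported norm-one functional
     comes within [e] of it. *)
  have yfin : ereal_sup [set (f y)%:E | f in [set f | [set f | dual f /\
      countable [set i | f (x i) != 0]] f /\ dual_norm f = 1]] \is a fin_num.
    by rewrite -norming.
  have [_ [f [[df cf] f1] <-]] := ub_ereal_sup_adherent e0 yfin.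
  rewrite -norming -EFinB lte_fin => fy.
  exists f; split=> //; first by move=> v; exact: dual_norm1_le df.1 f1.
  have [_ small_countable _] := regT.
  (* The countable support is bounded in [T], so [f] vanishes on all later terms. *)
  have [b bP] := small_countable _ _ (countable_preimage_inj ginj cf) id.
  exists b => a ba; apply/eqP; apply: contraTT ba => /bP.
  by rewrite -leNgt => /ltW.
- by exists d, T, ((x \o g) \o s); split=> //; [exact: omega1_like_limit | case: TO].
Qed.

End Plichko.

Theorem theorem1p1 (R : realType) :
  (forall (X : completeNormedModType R) (d : Order.disp_t) (K : orderType d)
      (x : K -> X),
    infinite_dimensional X ->
    uncountable_regular_cardinal K ->
    (forall a, `|x a| = 1) ->
    (weakly_null x ->
       has_subsequence (fun y => monotone_basic_sequence y) x) /\
    (property_C X ->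
       (dispersed x ->
          has_subsequence (fun y => bounded_biorthogonal_sequence y) x) /\
       (strongly_dispersed x ->
          has_subsequence (fun y => monotone_basic_sequence y) x))) /\
  (forall X : completeNormedModType R,
    infinite_dimensional X ->
    ~ separable X ->
    plichko X ->
    exists (d : Order.disp_t) (T : orderType d) (x : T -> X),
      [/\ limit_ordinal T, ~ countable [set: T] & monotone_basic_sequence x]).
Proof.
split=> [X d K x _ /uncountable_regular_order regK x1|X _]; last first.
  exact: plichko_monotone_basic.
have x0 a : x a != 0 by rewrite -normr_eq0 x1 oner_neq0.
split=> [wx|pC]; first by apply: monotone_subsequence => // y; exact: weakly_null_tail.
split=> [dx|[_ core0]]; first exact: bounded_biorthogonal_subsequence.
(* In the strongly dispersed case the core is {0}, and the distance to it is the norm. *)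
apply: monotone_subsequence => // y; have [b bP] := property_C_tail regK x y pC.
exists b => z bz; apply: le_trans (bP z bz).
apply: dist_to_ge => [|w]; first exact: tail_core_linear.
by rewrite /tail_core core0 => ->; rewrite addr0.
Qed.
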